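(* Let $G$ be a finite group of order $n = p_1^{\alpha_1} \cdots p_r^{\alpha_r}$, where $p_1,\dots,p_r$ are distinct primes and $\alpha_1,\dots,\alpha_r$ are positive integers. Then \[ |\mathcal{C}_G| \le \prod_{i=1}^r \left( \prod_{j=1}^{\alpha_i} \frac{p_i^j - 1}{p_i - 1} \right) \cdot \frac{\left(\sum_{i=1}^r \alpha_i\right)!}{\prod_{i=1}^r \alpha_i!}, \] and equality holds if and only if $G$ is an abelian group all of whose Sylow subgroups are elementary abelian.
   Context: For a finite group $G$, $\mathcal{C}_G$ denotes the set of all distinct composition series of $G$, i.e. chains of subgroups $\{e\} = G_0 \trianglelefteq G_1 \trianglelefteq \dots \trianglelefteq G_\ell = G$ with each $G_i/G_{i-1}$ simple; two composition series are distinct if they differ as chains of subgroups of $G$ (not merely up to isomorphism). *)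

(* Defs.v *)
From HB Require Import structures.
From mathcomp Require Import all_boot all_order all_algebra.
From mathcomp Require Import all_fingroup all_solvable.

Set Implicit Arguments.
Unset Strict Implicit.
Unset Printing Implicit Defensive.

Import Order.TTheory GRing.Theory Num.Theory.

Local Open Scope group_scope.

(* The library's [comps G s] says that [G :: s] decreases from G to 1, each
   term being a maximal proper normal subgroup of the preceding one; this is
   the definition of a composition series by normality and simple factors. *)
Lemma compsE (gT : finGroupType) (G : {group gT}) (s : seq {group gT}) :
  comps G s = ((last G s == 1%G) &&
    path [rel A B : {group gT} | (B <| A) && simple (A / B)] G s).
Proof.
congr (_ && _); apply: eq_path => A B /=; apply/idP/andP => [maxB | [nBA]].
  by rewrite quotient_simple (maxnormal_normal maxB).
by rewrite quotient_simple.
Qed.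

Lemma comps_size (gT : finGroupType) (G : {group gT}) (s : seq {group gT}) :
  comps G s -> size s <= #|G|.
Proof.
elim: s G => [|H s IHs] G //= csGs.
have /IHs le_s := comps_cons csGs; apply: leq_ltn_trans le_s _.
by case/compsP: csGs => _ /= /andP[/maxgroupp/andP[/proper_card]].
Qed.

(* The length bound #|G| only serves to make the type of sequences finite:
   [mem_comp_series] shows that no composition series is left out. *)
Definition comp_series (gT : finGroupType) (G : {group gT}) :
    {set #|G|.-bseq {group gT}} :=
  [set s : #|G|.-bseq {group gT} | comps G s].

Lemma mem_comp_series (gT : finGroupType) (G : {group gT})
    (s : seq {group gT}) :
  comps G s <-> exists2 t, t \in comp_series G & t = s :> seq _.
Proof.
split=> [csGs | [t] /[!inE] csGt <- //].
by exists (Bseq (comps_size csGs)); rewrite ?inE.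
Qed.

Local Open Scope ring_scope.

Definition comp_series_bound (r : nat) (p a : 'I_r -> nat) : rat :=
  (\prod_(i < r) \prod_(1 <= j < (a i).+1)
      (((p i)%:R ^+ j - 1) / ((p i)%:R - 1)))
  * (((\sum_(i < r) a i)`!)%N%:R / (\prod_(i < r) (a i)`!)%N%:R).

(* Main.v *)
(* Each maximal normal subgroup H of G contributes the composition series of H,
   so [#|comp_series G|] is the sum of the [#|comp_series H|].  Group the H by a
   prime p dividing #|G : H|, with P a Sylow p-subgroup of G.  If H and K are
   distinct then H K = G, whence (H :&: P)(K :&: P) = P by counting; so choosing
   a maximal subgroup of P above H :&: P is injective in H, and there are at
   most 1 + p + ... + p^(logn p #|G| - 1) such H. The bound satisfies the
   matching recursion, lowering one exponent at a time.
   In the equality case every H has prime power index, hence contains G', every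
   P has as many maximal subgroups as an elementary abelian group, and every
   maximal subgroup of P lies above some H :&: P; so G' meets P inside
   'Phi(P) = 1 for every P, and G' = 1. *)
From HB Require Import structures.
Require Import Defs.
From mathcomp Require Import all_boot all_order all_algebra.
From mathcomp Require Import all_fingroup all_solvable.

Set Implicit Arguments.
Unset Strict Implicit.
Unset Printing Implicit Defensive.

Import Order.TTheory GRing.Theory Num.Theory.
Import GroupScope.

Definition max_subgroups (gT : finGroupType) (G : {group gT}) :=
  [set M : {group gT} | maximal M G].

(** The index is only divisible by [q], not a power of it: a nonabelian simple factor places the
    same [H] under each prime dividing [#|G : H|]. *)
Definition max_normals (q : nat) (gT : finGroupType) (G : {group gT}) :=
  [set H : {group gT} | maxnormal H G G & q %| #|G : H|].

(** * Maximal subgroups of elementary abelian groups *)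

Section MaximalSubgroups.

Variable gT : finGroupType.
Implicit Types (E G H K L M P Q : {group gT}) (p q n : nat).

(* The L correspond to the p + 1 lines of E / K, less the line M / K. *)
Lemma card_max_subgroups_setI p E M K : prime p -> p.-abelem E ->
    maximal M E -> maximal K M ->
  #|[set L in max_subgroups E | (L != M) && (L :&: M == K :> {set gT})]| = p.
Proof.
move=> p_pr abE maxM maxK; have [pE cEE _] := and3P abE.
have sME : M \subset E by case/maxgroupP: maxM => /proper_sub.
have sKM : K \subset M by case/maxgroupP: maxK => /proper_sub.
have sKE := subset_trans sKM sME.
have nKE : E \subset 'N(K) by rewrite (sub_abelian_norm cEE).
have nsKE : K <| E by apply/andP.
have pM := pgroupS sME pE.
have iEM := p_maximal_index pE maxM; have iMK := p_maximal_index pM maxK.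
have iEK : #|E : K| = (p * p)%N by rewrite -(Lagrange_index sME sKM) iEM iMK.
have nKM := subset_trans sME nKE; have nsKM : K <| M by apply/andP.
have abEK : p.-abelem (E / K) := quotient_abelem K abE.
have oEK : #|E / K| = (p * p)%N by rewrite card_quotient.
have oMK : #|M / K| = p by rewrite card_quotient.
have E2 : (E / K)%G \in 'E_p^2(E / K).
  by apply/pnElemP; rewrite subxx abEK oEK mulnn pfactorK.
have E1 : (M / K)%G \in 'E_p^1(E / K).
  by rewrite p1ElemE // !inE quotientS //= oMK.
pose f (X : {group coset_of K}) := (coset K @*^-1 X)%G.
transitivity #|f @: ('E_p^1(E / K) :\ (M / K)%G)|.
  congr #|pred_of_set _|; apply/setP=> L; apply/idP/imsetP.
    rewrite !inE => /and3P[maxL neLM /eqP defK].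
    have sLE : L \subset E by case/maxgroupP: maxL => /proper_sub.
    have sKL : K \subset L by rewrite -defK subsetIl.
    have nsKL : K <| L by rewrite /normal sKL (subset_trans sLE).
    exists (L / K)%G; last by apply/val_inj; rewrite /= quotientGK.
    rewrite in_setD1 p1ElemE // !inE quotientS //=.
    rewrite card_quotient ?normal_norm //; have := Lagrange_index sLE sKL.
    rewrite (p_maximal_index pE maxL) iEK => /eqP.
    rewrite eqn_pmul2l ?prime_gt0 // => ->; rewrite andbT.
    apply: contraNneq neLM => /(congr1 val)/= eqLM; apply/eqP/val_inj.
    by rewrite /= -(quotientGK nsKL) eqLM quotientGK.
  case=> X /setD1P[neXM EX] ->; rewrite !inE.
  have oX := card_p1Elem EX.
  have sXE : X \subset E / K by case/pnElemP: EX.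
  apply/and3P; split.
  - rewrite -(quotientGK nsKE) cosetpre_maximal p_index_maximal //.
    by rewrite -divgS // oX oEK mulnK ?prime_gt0.
  - apply: contraNneq neXM => /(congr1 val)/= fXM; apply/eqP/val_inj.
    by rewrite /= -fXM cosetpreK.
  (* Two distinct subgroups of order p of [E / K] meet trivially, so their preimages meet in the
     kernel [K]. *)
  rewrite -{1}(quotientGK nsKM) /= -morphpreI.
  suff -> : X :&: (M / K) = 1 by apply/eqP; apply: ker_coset.
  apply/eqP; apply: contraNT neXM => ntI.
  have /prime_meetG : prime #|X| by rewrite oX.
  move=> /(_ (M / K)%G ntI) sXM; apply/eqP/val_inj/eqP.
  by rewrite eqEcard sXM /= oX oMK.
rewrite card_imset.
  by have := cardsD1 (M / K)%G 'E_p^1(E / K);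
     rewrite (card_p1Elem_p2Elem E2) E1 => -[].
move=> X Y /(congr1 val)/= /(congr1 (quotient^~ K)).
by rewrite !cosetpreK => /val_inj.
Qed.

(** Induction on n. Fix a maximal [M]; every other maximal [L] cuts [M] in a maximal subgroup of
    [M], and each of these arises from exactly p such [L]. The count is therefore 1 plus p times the
    count for [M]. *)
Lemma card_max_subgroups_abelem p n E : prime p -> p.-abelem E ->
    #|E| = (p ^ n)%N ->
  #|max_subgroups E| = (\sum_(i < n) p ^ i)%N.
Proof.
move=> p_pr; elim: n E => [|n IHn] E abE oE; have [pE cEE _] := and3P abE.
  rewrite big_ord0; apply: eq_card0 => M; rewrite !inE; apply/negP.
  case/maxgroupP=> /proper_card; rewrite oE expn0 ltnS leqn0.
  by rewrite -[_ == 0]negbK -lt0n cardG_gt0.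
have [E1 | [M maxM _]] := maximal_exists (sub1G E).
  have : 1 < p ^ n.+1 by rewrite -(expn0 p) ltn_exp2l ?prime_gt1.
  by rewrite -oE -E1 cards1.
have sME : M \subset E by case/maxgroupP: maxM => /proper_sub.
have p_gt0 := prime_gt0 p_pr.
have oM : #|M| = (p ^ n)%N.
  apply/eqP; rewrite -(eqn_pmul2r p_gt0) -{1}(p_maximal_index pE maxM).
  by rewrite Lagrange // oE expnSr.
rewrite big_ord_recl expn0 (cardsD1 M) inE maxM; congr (_ + _)%N.
under eq_bigr do rewrite /= /bump add1n expnS.
rewrite -big_distrr /= -(IHn M (abelemS sME abE)) // mulnC -sum_nat_const.
rewrite -sum1_card.
rewrite (partition_big (fun L => (L :&: M)%G) (mem (max_subgroups M))).
  apply: eq_bigr => K /[!inE] maxK.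
  rewrite -(card_max_subgroups_setI p_pr abE maxM maxK) -sum1dep_card.
  by apply: eq_bigl => L; rewrite !inE [_ && maximal _ _]andbC andbA.
move=> L /[!inE] /andP[neLM maxL].
have sLE : L \subset E by case/maxgroupP: maxL => /proper_sub.
have oEL : (#|L| * p)%N = #|E| by rewrite -(p_maximal_index pE maxL) Lagrange.
(* Once [L * M = E], the product formula gives [L :&: M] index p in [M]. *)
have defE : L * M = E.
  apply: mulg_normal_maximal => //; first exact: p_maximal_normal pE maxL.
  apply: contra neLM => sML; apply/eqP/esym/val_inj/eqP; rewrite eqEcard sML /=.
  by rewrite -(leq_pmul2r p_gt0) oEL oE oM expnSr.
apply: p_index_maximal; first exact: subsetIr.
rewrite -divgS ?subsetIr //=; have := mul_cardG L M.
rewrite defE -oEL -mulnA => /eqP; rewrite eqn_pmul2l ?cardG_gt0 // => /eqP->.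
by rewrite mulnK ?cardG_gt0.
Qed.

End MaximalSubgroups.

(** * Maximal subgroups of p-groups and maximal normal subgroups of finite groups *)

Section MaximalNormalSubgroups.

Variable gT : finGroupType.
Implicit Types (G H K M P : {group gT}) (p : nat).

(** All maximal subgroups contain ['Phi(P)], so the correspondence theorem applies. *)
Lemma card_max_subgroups_quotient_Phi p P : p.-group P ->
  #|max_subgroups P| = #|max_subgroups (P / 'Phi(P))%G|.
Proof.
move=> pP; have nsPhi : 'Phi(P) <| P := Phi_normal P.
have nsPhiM M : maximal M P -> 'Phi(P) <| M.
  move=> maxM; have sMP : M \subset P by case/maxgroupP: maxM => /proper_sub.
  by apply: normalS nsPhi; rewrite ?Phi_sub_max.
pose f M := (M / 'Phi(P))%G; rewrite -(card_in_imset (f := f)) => [|M N].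
  congr #|pred_of_set _|; apply/setP=> X.
  apply/imsetP/idP=> [[M /[!inE] maxM ->]|].
    by rewrite quotient_maximal // nsPhiM.
  rewrite inE => maxX; exists (coset 'Phi(P) @*^-1 X)%G; last first.
    by apply/val_inj; rewrite /= cosetpreK.
  by have := cosetpre_maximal X (P / 'Phi(P)); rewrite inE quotientGK // maxX.
rewrite !inE => /nsPhiM nM /nsPhiM nN /(congr1 val)/= eqMN; apply/val_inj.
by rewrite /= -(quotientGK nM) eqMN quotientGK.
Qed.

(** The quotient [P / 'Phi(P)] is elementary abelian, so the count is the initial part of the sum
    with logn p |P : 'Phi(P)| terms. The missing terms are positive powers of p, so equality holds
    exactly when ['Phi(P)] is trivial. *)
Lemma leq_card_max_subgroups p P : prime p -> p.-group P ->
  #|max_subgroups P| <= \sum_(i < logn p #|P|) p ^ i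
    ?= iff p.-abelem P.
Proof.
move=> p_pr pP; have abP := Phi_quotient_abelem pP.
have oP := card_pgroup (abelem_pgroup abP).
rewrite (card_max_subgroups_quotient_Phi pP).
rewrite (card_max_subgroups_abelem p_pr abP oP) -trivg_Phi //.
rewrite card_quotient ?normal_norm ?Phi_normal //.
have /esym := LagrangeI P 'Phi(P); rewrite (setIidPr (Phi_sub P)) => ->.
rewrite lognM ?cardG_gt0 // addnC; set k := logn p #|_ : _|.
rewrite big_split_ord /=; split; first exact: leq_addr.
rewrite -[X in X == _]addn0 eqn_add2l eq_sym.
have pPhi := pgroupS (Phi_sub P) pP.
have [-> | ntPhi] := eqVneq 'Phi(P) 1; first by rewrite cards1 logn1 big_ord0.
have [_ _ [m ->]] := pgroup_pdiv pPhi ntPhi.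
rewrite pfactorK // big_ord_recl /= addn_eq0.
by rewrite expn_eq0 -leqn0 leqNgt prime_gt0.
Qed.

(** The first two properties of [f] give the upper bound on [max_normals]; the third serves the
    equality case. *)
Lemma max_normals_inj p G P : prime p -> p.-Sylow(G) P ->
  exists f : {group gT} -> {group gT},
    [/\ {in max_normals p G &, injective f},
        {in max_normals p G, forall H, f H \in max_subgroups P}
      & {in max_normals p G, forall H, H :&: P \subset f H}].
Proof.
move=> p_pr sylP; have sPG := pHall_sub sylP; have pP := pHall_pgroup sylP.
(* The default [P] is never taken on [max_normals p G], as [fP] shows. *)
pose f H := odflt P [pick M : {group gT} | maximal M P & H :&: P \subset M].
have fP H : H \in max_normals p G -> maximal (f H) P && (H :&: P \subset f H).
  rewrite inE /f => /andP[maxH pGH].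
  case: pickP => [M -> //| noM]; exfalso.
  have nsHG := maxnormal_normal maxH.
  have [defP | [M maxM sHPM]] := maximal_exists (subsetIr H P); last first.
    by have := noM M; rewrite maxM sHPM.
  (* If [P] lay in [H], then |G : H| would divide |G : P|, which is prime to p. *)
  have sPH : P \subset H by rewrite -defP subsetIl.
  have /and3P[_ _] := sylP; rewrite p'natE // => /negP[].
  rewrite (dvdn_trans pGH) // -(Lagrange_index (normal_sub nsHG) sPH).
  exact: dvdn_mulr.
exists f; split=> [H K nH nK eqf | H /fP | H /fP/andP[]//]; last first.
  by rewrite inE => /andP[].
have /andP[maxM sHM] := fP H nH; have /andP[_ sKM] := fP K nK.
rewrite -eqf in sKM; move: (f H) maxM sHM sKM => M maxM sHM sKM.
apply/eqP; apply/negPn/negP => neHK.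
have [/[!inE] /andP[maxH _] /andP[maxK _]] := (nH, nK).
have defG : H * K = G.
  by apply: maxnormalM => // eqHK; case/eqP: neHK; apply/val_inj.
have [nsHG nsKG] := (maxnormal_normal maxH, maxnormal_normal maxK).
have sylH := Sylow_setI_normal nsHG sylP.
have sylK := Sylow_setI_normal nsKG sylP.
have sylHK := Sylow_setI_normal (normalI nsHG nsKG) sylP.
(* Compare this product formula with the p-part of the one for [H * K = G]. Since [P] meets [H], [K]
   and [H :&: K] in Sylow subgroups, the product of [H :&: P] and [K :&: P] has |P| elements, yet it
   lies in the proper subgroup [M]. *)
have := mul_cardG (H :&: P) (K :&: P).
rewrite -setIIl; set HPKP := _ * _ => oHPKP.
have := mul_cardG H K; rewrite defG => /(congr1 (partn^~ p)).
rewrite !partnM ?cardG_gt0 // -(card_Hall sylH) -(card_Hall sylK).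
rewrite -(card_Hall sylHK) -(card_Hall sylP) oHPKP => /eqP.
rewrite eqn_pmul2r ?cardG_gt0 // => /eqP oPM.
have /proper_card : M \proper P by case/maxgroupP: maxM.
by rewrite ltnNge -oPM subset_leq_card // mul_subG.
Qed.

Lemma leq_card_max_normals p G P : prime p -> p.-Sylow(G) P ->
  #|max_normals p G| <= \sum_(i < logn p #|G|) p ^ i.
Proof.
move=> p_pr sylP; have [f [injf fP _]] := max_normals_inj p_pr sylP.
rewrite -(card_in_imset injf).
have oP : logn p #|G| = logn p #|P| by rewrite (card_Hall sylP) logn_part.
have [leP _] := leq_card_max_subgroups p_pr (pHall_pgroup sylP).
rewrite oP (leq_trans _ leP) // subset_leq_card //.
by apply/subsetP=> _ /imsetP[H nH ->]; apply: fP.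
Qed.

(** Equality forces [P] to have as many maximal subgroups as an elementary abelian group, and forces
    the injection [f] to be onto them. The intersection then lies in every maximal subgroup of [P],
    hence in ['Phi(P)], which is trivial. *)
Lemma eq_card_max_normals p G P : prime p -> p.-Sylow(G) P ->
    #|max_normals p G| = (\sum_(i < logn p #|G|) p ^ i)%N ->
  p.-abelem P /\ \bigcap_(H in max_normals p G) H :&: P = 1.
Proof.
move=> p_pr sylP; have [f [injf fP sHf]] := max_normals_inj p_pr sylP.
have pP := pHall_pgroup sylP.
have oP : logn p #|G| = logn p #|P| by rewrite (card_Hall sylP) logn_part.
have [leP eqP_abelem] := leq_card_max_subgroups p_pr pP.
have sfP : f @: max_normals p G \subset max_subgroups P.
  by apply/subsetP=> _ /imsetP[H nH ->]; apply: fP.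
rewrite oP => oN; have abP : p.-abelem P.
  by rewrite -eqP_abelem eqn_leq leP -oN -(card_in_imset injf) subset_leq_card.
split=> //; apply/trivgP => /=.
have /eqP<- : 'Phi(P) == 1 by rewrite (trivg_Phi pP).
have /eqP f_onto : f @: max_normals p G == max_subgroups P.
  by rewrite eqEcard sfP (card_in_imset injf) oN.
apply/bigcapsP=> M /predU1P[/val_inj-> | maxM]; first exact: subsetIr.
have : M \in max_subgroups P by rewrite inE.
rewrite -f_onto => /imsetP[H nH ->]; apply: subset_trans (sHf H nH).
by rewrite setSI // bigcap_inf.
Qed.

(** For the lower bound, [G] is the direct product of [P] and ['O_p^'(G)]; a maximal subgroup [M] of
    [P] yields the subgroup [M <*> 'O_p^'(G)] of index p, from which [M] is recovered by
    intersecting with [P]. *)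
Lemma card_max_normals_abelian p G P : prime p -> abelian G ->
    p.-Sylow(G) P -> p.-abelem P ->
  #|max_normals p G| = (\sum_(i < logn p #|G|) p ^ i)%N.
Proof.
move=> p_pr cGG sylP abP; apply/eqP.
rewrite eqn_leq (leq_card_max_normals p_pr sylP).
have pP := pHall_pgroup sylP; have sPG := pHall_sub sylP.
have oP : logn p #|G| = logn p #|P| by rewrite (card_Hall sylP) logn_part.
rewrite oP -(card_max_subgroups_abelem p_pr abP (card_pgroup pP)) /=.
pose f M := (M <*> 'O_p^'(G))%G.
have fI M : M \in max_subgroups P -> f M :&: P = M.
  rewrite inE => /maxgroupp/proper_sub sMP; have sMG := subset_trans sMP sPG.
  rewrite /= norm_joinEl ?(subset_trans sMG) ?gFnorm //.
  (* Dedekind's modular law, followed by coprimality of [P] and ['O_p^'(G)]. *)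
  rewrite -group_modl // setIC coprime_TIg ?mulg1 //.
  exact: pnat_coprime pP (pcore_pgroup _ _).
rewrite -(card_in_imset (f := f)) => [|M N /fI fM /fI fN eqf]; last first.
  by apply/val_inj; rewrite -[LHS]fM eqf fN.
apply/subset_leq_card/subsetP=> _ /imsetP[M mM ->].
have maxM : maximal M P by rewrite inE in mM.
have iMP := p_maximal_index pP maxM.
have [sMP sOG] := (proper_sub (maxgroupp maxM), pcore_sub p^' G).
have iG : #|G : f M| = p.
  have sMG := subset_trans sMP sPG.
  have oG : (#|P| * #|'O_p^'(G)|)%N = #|G|.
    rewrite (card_Hall sylP) (card_Hall (nilpotent_pcore_Hall _ _)) ?partnC //.
    exact: abelian_nil.
  have ofM : (#|M| * #|'O_p^'(G)|)%N = #|f M|.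
    rewrite /= norm_joinEl ?(subset_trans sMG) ?gFnorm // TI_cardMg //.
    exact: coprime_TIg (pnat_coprime (pgroupS sMP pP) (pcore_pgroup _ _)).
  rewrite -divgS ?join_subG ?sMG // -oG -ofM divnMr ?cardG_gt0 //.
  by rewrite divgS.
have sfG : f M \subset G by rewrite join_subG (subset_trans sMP).
have /maxgroupP[fMG maxfM] : maximal (f M) G by rewrite p_index_maximal ?iG.
rewrite inE iG dvdnn andbT; apply/maxgroupP.
rewrite fMG (sub_abelian_norm cGG) //; split=> // K /andP[KG _]; exact: maxfM.
Qed.

End MaximalNormalSubgroups.

(** * Recursion for the number of composition series *)

Lemma card_comp_series1 (gT : finGroupType) (G : {group gT}) :
  G :=: 1 -> #|comp_series G| = 1%N.
Proof.
move/eqP=> G1; apply/eqP/cards1P; have cs0 : comps G [::].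
  by rewrite /comps /= andbT -(inj_eq val_inj).
exists (Bseq (comps_size cs0)); apply/setP=> s; rewrite !inE.
apply/idP/eqP => [/trivg_comps | -> //]; rewrite G1 => /esym/eqP s0.
exact/val_inj.
Qed.

Lemma card_comp_series_gt0 (gT : finGroupType) (G : {group gT}) :
  0 < #|comp_series G|.
Proof.
have [s /mem_comp_series[t Gt _]] := exists_comps G.
by apply/card_gt0P; exists t.
Qed.

Lemma card_comp_series_rec (gT : finGroupType) (G : {group gT}) : G :!=: 1 ->
  #|comp_series G| =
    (\sum_(H : {group gT} | maxnormal H G G) #|comp_series H|)%N.
Proof.
move=> ntG; pose hd (s : #|G|.-bseq {group gT}) := head 1%G s.
have consP (s : #|G|.-bseq {group gT}) : s \in comp_series G ->
    exists (H : {group gT}) (t : seq {group gT}),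
      [/\ maxnormal H G G, comps H t & s = H :: t :> seq _].
  rewrite inE => csGs; have := trivg_comps csGs; rewrite (negPf ntG).
  move: csGs; case: {s}(s : seq _) => // H t csGt _; exists H, t; split=> //.
    by case/andP: csGt => _ /= /andP[].
  exact: comps_cons csGt.
rewrite -sum1_card.
rewrite (partition_big hd (fun H : {group gT} => maxnormal H G G))
  => [|s /consP]; last first.
  by rewrite /hd => -[H [t [maxH _ ->]]].
apply: eq_bigr => H maxH; rewrite sum1dep_card.
(* Prepending [H] never exceeds the length limit, because |H| < |G|; so [insub_bseq] does not fall
   back on its default. *)
pose f (s : #|H|.-bseq {group gT}) := insub_bseq #|G| (H :: s).
have le_s s : comps H s -> size (H :: s) <= #|G|.
  move/comps_size/leq_ltn_trans=> -> //.
  exact/proper_card/(maxnormal_proper maxH).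
have fE s : s \in comp_series H -> f s = H :: s :> seq _.
  by rewrite inE /f => /le_s le_Hs; rewrite /insub_bseq insubdK.
rewrite -(card_in_imset (f := f)) => [|s t Hs Ht]; last first.
  by move/(congr1 (@bseqval _ _)); rewrite !fE // => -[] /val_inj.
congr #|pred_of_set _|; apply/setP=> s; rewrite inE; apply/andP/imsetP.
  case=> /consP[K [t [maxK cst defs]]] /eqP; rewrite /hd defs /= => defK.
  rewrite {K}defK in maxK cst defs.
  exists (Bseq (comps_size cst)); first by rewrite inE.
  by apply/val_inj; rewrite /= fE ?inE.
case=> t Ht ->; rewrite /hd !inE !fE //=; split=> //.
by move: Ht; rewrite inE /comps /= maxH.
Qed.

(** * Recursion for the bound *)

Section Bound.

Variables (r : nat) (p : 'I_r -> nat).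
Hypothesis p_inj : injective p.
Hypothesis p_prime : forall i, prime (p i).
Implicit Types (a : 'I_r -> nat) (i j : 'I_r).

(** Subtraction is truncated, so [a] is unchanged when [a i = 0]; in the recursion such an index has
    an empty sum as coefficient. *)
Definition lower a i : 'I_r -> nat := fun j => (a j - (j == i))%N.

Lemma sum_lower a i : 0 < a i -> (\sum_j a j = (\sum_j lower a i j).+1)%N.
Proof.
move=> ai_gt0; rewrite (bigD1 i) //= [in RHS](bigD1 i) //= /lower eqxx subn1.
rewrite -addSn prednK //; congr (_ + _)%N; apply: eq_bigr => j /negPf->.
by rewrite subn0.
Qed.

Lemma prod_lower a i :
  0 < a i -> (\prod_j p j ^ a j = p i * \prod_j p j ^ lower a i j)%N.
Proof.
move=> ai_gt0; rewrite (bigD1 i) //= [in RHS](bigD1 i) //= /lower eqxx subn1.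
rewrite mulnA -expnS prednK //; congr (_ * _)%N.
by apply: eq_bigr => j /negPf->; rewrite subn0.
Qed.

Lemma logn_prod_pfactor a i : logn (p i) (\prod_j p j ^ a j) = a i.
Proof.
transitivity (\sum_j logn (p i) (p j ^ a j))%N.
  (* Positivity of the partial product is carried along for the use of [lognM]. *)
  pose K (m n : nat) := logn (p i) m = n /\ 0 < m.
  suff [] : K (\prod_j p j ^ a j)%N (\sum_j logn (p i) (p j ^ a j))%N by [].
  apply: big_rec2 => [|j m n _ [<- m_gt0]]; first by rewrite /K logn1.
  have pj_gt0 : 0 < p j ^ a j by rewrite expn_gt0 prime_gt0.
  by rewrite /K lognM // muln_gt0 pj_gt0.
rewrite (bigD1 i) //= big1 ?addn0 => [|j neji]; first exact: pfactorK.
by rewrite lognX logn_prime // (inj_eq p_inj) eq_sym (negPf neji) muln0.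
Qed.

Local Open Scope ring_scope.

Lemma comp_series_bound0 a : (\sum_i a i = 0)%N -> comp_series_bound p a = 1.
Proof.
move/eqP; rewrite sum_nat_eq0 => /forallP a0.
have {}a0 i : a i = 0%N by apply/eqP/(implyP (a0 i)).
rewrite /comp_series_bound !big1 ?fact0 ?divr1 ?mulr1 // => i _; rewrite a0 //.
by rewrite big_geq.
Qed.

Lemma comp_series_bound_gt0 a : 0 < comp_series_bound p a.
Proof.
rewrite /comp_series_bound mulr_gt0 //; last first.
  by rewrite divr_gt0 // ltr0n ?fact_gt0 // prodn_gt0 // => i; rewrite fact_gt0.
apply: prodr_gt0 => i _; rewrite big_nat; apply: prodr_gt0 => j /andP[j_gt0 _].
by rewrite divr_gt0 // subr_gt0 ?exprn_egt1 ?ltr1n ?prime_gt1 -?lt0n.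
Qed.

(** Lowering [a i] removes one factor of the product, a geometric sum, while the multinomial
    coefficient satisfies Pascal's rule. *)
Lemma comp_series_bound_rec a : (0 < \sum_i a i)%N ->
  comp_series_bound p a =
    \sum_i (\sum_(k < a i) p i ^ k)%N%:R * comp_series_bound p (lower a i).
Proof.
move=> a_gt0; pose F i n : rat :=
  \prod_(1 <= j < n.+1) (((p i)%:R ^+ j - 1) / ((p i)%:R - 1)).
have FS i n : F i n.+1 = (\sum_(k < n.+1) p i ^ k)%N%:R * F i n.
  rewrite /F big_nat_recr //= mulrC; congr (_ * _).
  apply: (mulIf (x := (p i)%:R - 1)).
    by rewrite subr_eq0 eq_sym (eqr_nat _ 1) neq_ltn prime_gt1.
  rewrite divfK; last first.
    by rewrite subr_eq0 eq_sym (eqr_nat _ 1) neq_ltn prime_gt1.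
  rewrite subrX1 mulrC natr_sum; congr (_ * _).
  by apply: eq_bigr => k _; rewrite natrX.
set N := (\sum_i a i)%N in a_gt0 *.
(* Write N! as the sum over i of a_i (N - 1)!; the factor a_i then cancels against a_i!. *)
transitivity (\sum_i (\prod_j F j (a j)) *
    ((a i)%:R * (N.-1`!)%:R / (\prod_j (a j)`!)%N%:R)).
  rewrite -mulr_sumr -!mulr_suml -natr_sum -/N -natrM /comp_series_bound -/N.
  by rewrite -{1}(prednK a_gt0) factS (prednK a_gt0).
apply: eq_bigr => i _; have [ai0 | ai_gt0] := posnP (a i).
  by rewrite ai0 big_ord0 !mul0r mulr0.
have := sum_lower ai_gt0; rewrite /comp_series_bound -/N.
move: (\sum_j lower a i j)%N => m ->; rewrite /= [RHS]mulrA; congr (_ * _).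
  rewrite (bigD1 i) //= [in RHS](bigD1 i) //= [RHS]mulrA; congr (_ * _).
    by rewrite /lower eqxx subn1; case: (a i) ai_gt0 => // m _; apply: FS.
  by apply: eq_bigr => j /negPf; rewrite /lower => ->; rewrite subn0.
rewrite (bigD1 i) //= [in RHS](bigD1 i) //= /lower eqxx subn1.
have -> : (\prod_(j < r | j != i) (a j - (j == i))`! =
           \prod_(j < r | j != i) (a j)`!)%N.
  by apply: eq_bigr => j /negPf->; rewrite subn0.
rewrite -{2}(prednK ai_gt0) factS (prednK ai_gt0) -mulnA [in LHS]natrM.
rewrite invfM mulrACA mulfV ?mul1r //.
by rewrite pnatr_eq0 -lt0n.
Qed.

End Bound.

(** * The upper bound and the case of equality *)

Section UpperBound.

Variables (r : nat) (p : 'I_r -> nat).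
Hypothesis p_inj : injective p.
Hypothesis p_prime : forall i, prime (p i).
Variable gT : finGroupType.
Implicit Types (a : 'I_r -> nat) (i j : 'I_r) (G H P Q : {group gT}).

Lemma dvdn_prod_pfactor a (q : nat) :
  prime q -> q %| (\prod_i p i ^ a i)%N -> exists2 i, q = p i & 0 < a i.
Proof.
move=> q_pr; rewrite Euclid_dvd_prod // big_orE => /existsP[i] /=.
rewrite Euclid_dvdX // => /andP[q_dv ai_gt0]; exists i => //.
by apply/eqP; rewrite -dvdn_prime2.
Qed.

(** Divisibility, unlike equality, passes from [G] to [H] even when |G : H| is larger than [p i];
    this is why the bound is proved for all [G] whose order divides the product. *)
Lemma max_normals_lower a i G H :
    #|G| %| (\prod_i p i ^ a i)%N -> H \in max_normals (p i) G ->
  [/\ 0 < a i & #|H| %| (\prod_j p j ^ lower a i j)%N].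
Proof.
move=> dvG /[!inE] /andP[maxH /dvdnP[k iH]].
have oG := Lagrange (maxnormal_sub maxH).
have dv_pG : p i %| #|G| by rewrite -oG iH mulnA dvdn_mull.
have dv_p := dvdn_trans dv_pG dvG.
have [j /p_inj<- ai_gt0] := dvdn_prod_pfactor (p_prime i) dv_p.
split=> //; rewrite -(dvdn_pmul2l (prime_gt0 (p_prime i))) -prod_lower //.
by rewrite (dvdn_trans _ dvG) // -oG iH mulnC dvdn_mul ?dvdn_mull.
Qed.

(** On the right each [H] is counted once for every [p i] dividing its index, so at least once. As
    [H] has at least one series, equality means exactly once for every [H]. *)
Lemma leqif_card_comp_series a G :
    G :!=: 1 -> #|G| %| (\prod_i p i ^ a i)%N ->
  #|comp_series G| <= \sum_i \sum_(H in max_normals (p i) G) #|comp_series H|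
    ?= iff [forall (H : {group gT} | maxnormal H G G),
             #|[set i | p i %| #|G : H|]| == 1%N].
Proof.
move=> ntG dvG; rewrite card_comp_series_rec //.
have -> : (\sum_i \sum_(H in max_normals (p i) G) #|comp_series H| =
    \sum_(H : {group gT} | maxnormal H G G)
      #|[set i | p i %| #|G : H|]| * #|comp_series H|)%N.
  rewrite (exchange_big_dep (fun H : {group gT} => maxnormal H G G)) /=.
    apply: eq_bigr => H maxH; rewrite -sum_nat_const.
    by apply: eq_bigl => i; rewrite !inE maxH.
  by move=> i H _ /[!inE] /andP[].
apply: leqif_sum => H maxH; have cH_gt0 := card_comp_series_gt0 H.
suff iH_gt0 : 0 < #|[set i | p i %| #|G : H|]|.
  split; first by rewrite leq_pmull.
  by rewrite -[X in X == _]mul1n eqn_pmul2r // eq_sym.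
have iH_gt1 : 1 < #|G : H|.
  by rewrite indexg_gt1 proper_subn ?(maxnormal_proper maxH).
have [|i pdivE _] := @dvdn_prod_pfactor a _ (pdiv_prime iH_gt1).
  by rewrite (dvdn_trans (pdiv_dvd _)) // (dvdn_trans (dvdn_indexg _ _)).
by apply/card_gt0P; exists i; rewrite inE -pdivE pdiv_dvd.
Qed.

Local Open Scope ring_scope.

Lemma leq_sum_expn (q m n : nat) :
  (m <= n -> \sum_(k < m) q ^ k <= \sum_(k < n) q ^ k)%N.
Proof.
move=> le_mn; rewrite -!(big_mkord predT (fun k => q ^ k)%N).
by rewrite (big_cat_nat (leq0n m) le_mn) /= leq_addr.
Qed.

Lemma card_max_normals_le a G i : (#|G| %| \prod_i p i ^ a i)%N ->
  (#|max_normals (p i) G| <= \sum_(k < a i) p i ^ k)%N.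
Proof.
move=> dvG; have [P sylP] := Sylow_exists (p i) G.
apply: leq_trans (leq_card_max_normals (p_prime i) sylP) _; apply: leq_sum_expn.
rewrite -[leqRHS](logn_prod_pfactor p_inj p_prime) dvdn_leq_log //.
by apply: prodn_gt0 => j; rewrite expn_gt0 prime_gt0.
Qed.

(** The bound for subgroups is a hypothesis so that both the induction and the later equality
    analysis can supply it. *)
Lemma sum_max_normals_le a G i :
    (#|G| %| \prod_i p i ^ a i)%N ->
    (forall H, (#|H| %| \prod_j p j ^ lower a i j)%N ->
       #|comp_series H|%:R <= comp_series_bound p (lower a i)) ->
  (\sum_(H in max_normals (p i) G) #|comp_series H|)%N%:R <=
    #|max_normals (p i) G|%:R * comp_series_bound p (lower a i).
Proof.
move=> dvG leB; rewrite natr_sum mulr_natl -sumr_const.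
by apply: ler_sum => H /(max_normals_lower dvG)[_ /leB].
Qed.

Lemma card_comp_series_le a G : (#|G| %| \prod_i p i ^ a i)%N ->
  #|comp_series G|%:R <= comp_series_bound p a.
Proof.
have [n] := ubnP (\sum_i a i)%N; elim: n a G => // n IHn a G lt_a_n dvG.
have IH i H : (0 < a i)%N -> (#|H| %| \prod_j p j ^ lower a i j)%N ->
    #|comp_series H|%:R <= comp_series_bound p (lower a i).
  by move=> ai_gt0; apply: IHn; move: lt_a_n; rewrite (sum_lower ai_gt0).
have B_ge0 b : 0 <= comp_series_bound p b by rewrite ltW ?comp_series_bound_gt0.
have [a0 | a_gt0] := posnP (\sum_i a i)%N.
  rewrite comp_series_bound0 // card_comp_series1 //; apply/card1_trivg/eqP.
  rewrite -dvdn1; move/eqP: a0; rewrite sum_nat_eq0 => /forallP a0.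
  by rewrite big1 in dvG => // i _; rewrite (eqP (implyP (a0 i) _)).
rewrite comp_series_bound_rec //; have [G1 | ntG] := eqVneq (G : {set gT}) 1%g.
  (* The recursion on series fails for the trivial group. One term suffices here: its bound is at
     least the count by induction, and its coefficient is at least 1. *)
  move: a_gt0; rewrite lt0n sum_nat_eq0 => /forallPn[i].
  rewrite /= -lt0n => ai_gt0.
  rewrite (bigD1 i) //= ler_wpDr ?sumr_ge0 // => [j _|]; first exact: mulr_ge0.
  rewrite (le_trans (IH i G ai_gt0 _)) ?G1 ?cards1 ?dvd1n // ler_peMl // ler1n.
  by case: (a i) ai_gt0 => // m _; rewrite big_ord_recl.
have [leG _] := leqif_card_comp_series ntG dvG.
rewrite -(ler_nat rat) in leG; apply: le_trans leG _; rewrite natr_sum.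
apply: ler_sum => i _; have [ai0 | ai_gt0] := posnP (a i).
  rewrite big1 => [|H /(max_normals_lower dvG)[]]; last by rewrite ai0.
  exact: mulr_ge0.
apply: le_trans (sum_max_normals_le dvG _) _ => [H|]; first exact: IH.
by rewrite ler_wpM2r // ler_nat card_max_normals_le.
Qed.

(** The count, the sum [X], the sum of the [c i] and the bound form an increasing chain with equal
    ends. Equality at the last link fixes the sizes of the [max_normals]; at the first it leaves one
    prime per index. *)
Lemma card_comp_series_eq_bound a G : #|G| = (\prod_i p i ^ a i)%N ->
    #|comp_series G|%:R = comp_series_bound p a ->
  [/\ forall i, #|max_normals (p i) G| = (\sum_(k < a i) p i ^ k)%N
    & forall i H, H \in max_normals (p i) G -> (p i).-nat #|G : H|].
Proof.
move=> oG eqB; have dvG : (#|G| %| \prod_i p i ^ a i)%N by rewrite oG.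
have defa i : a i = logn (p i) #|G| by rewrite oG logn_prod_pfactor.
have [G1 | ntG] := eqVneq (G : {set gT}) 1%g.
  have mG0 i : max_normals (p i) G = set0.
    apply/setP=> H; rewrite [RHS]inE; apply/negP=> /(max_normals_lower dvG)[].
    by rewrite defa G1 cards1 logn1.
  split=> [i | i H]; last by rewrite mG0 inE.
  by rewrite mG0 cards0 defa G1 cards1 logn1 big_ord0.
have a_gt0 : (0 < \sum_i a i)%N.
  rewrite lt0n sum_nat_eq0; apply: contra ntG => /forallP a0.
  rewrite trivg_card1 oG big1 // => i _.
  by have /implyP/(_ isT)/eqP-> := a0 i.
pose c i : rat := #|max_normals (p i) G|%:R * comp_series_bound p (lower a i).
have le_c i : xpredT i -> c i <=
   (\sum_(k < a i) p i ^ k)%N%:R * comp_series_bound p (lower a i)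
   ?= iff (#|max_normals (p i) G| == (\sum_(k < a i) p i ^ k)%N).
  move=> _; have B_gt0 := comp_series_bound_gt0 p_prime (lower a i).
  split; first by rewrite ler_wpM2r ?(ltW B_gt0) // ler_nat card_max_normals_le.
  by rewrite (inj_eq (mulIf (lt0r_neq0 B_gt0))) eqr_nat.
have [leG eqG] := leqif_card_comp_series ntG dvG.
set X := (\sum_i \sum_(H in _) _)%N in leG eqG.
have leXc : X%:R <= \sum_i c i.
  rewrite natr_sum; apply: ler_sum => i _; apply: sum_max_normals_le => // H.
  exact: card_comp_series_le.
have [lec eqc] := leif_sum le_c; rewrite -comp_series_bound_rec // in lec eqc.
have eqX : X = #|comp_series G|.
  apply/eqP; rewrite eqn_leq leG andbT -(ler_nat rat) eqB.
  exact: le_trans leXc lec.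
move: eqc; have -> : (\sum_i c i == comp_series_bound p a).
  by rewrite eq_le lec -eqB -eqX.
move/esym/forallP=> mGE; move: eqG; rewrite eqX eqxx => /esym/forallP iGE.
split=> [i | i H mH]; first by apply/eqP/(implyP (mGE i)).
have /[!inE] /andP[maxH pi_iH] := mH.
have /cards1P[j iE] := implyP (iGE H) maxH.
apply/pnatP=> // q q_pr q_iH.
have [k qE _] : exists2 k, q = p k & (0 < a k)%N.
  by apply: dvdn_prod_pfactor => //; rewrite -oG (dvdn_trans q_iH) ?dvdn_indexg.
have eq_j l : (p l %| #|G : H|)%N = (l == j) by rewrite -in_set1 -iE inE.
have /eqP-> : i == j by rewrite -eq_j.
have /eqP<- : k == j by rewrite -eq_j -qE.
by rewrite qE inE.
Qed.

Lemma card_comp_series_eq_bound_abelian a G : #|G| = (\prod_i p i ^ a i)%N ->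
    #|comp_series G|%:R = comp_series_bound p a ->
  abelian G /\
    (forall (q : nat) Q, prime q -> (q.-Sylow(G) Q)%g -> (q.-abelem Q)%g).
Proof.
move=> oG eqB; have [mGE iGE] := card_comp_series_eq_bound oG eqB.
have defa i : a i = logn (p i) #|G| by rewrite oG logn_prod_pfactor.
have eq_p i P : ((p i).-Sylow(G) P)%g -> (p i).-abelem%g P /\
    (\bigcap_(H in max_normals (p i) G) H :&: P)%g = 1%g.
  by move=> sylP; apply: eq_card_max_normals (sylP) _ => //; rewrite -defa.
split=> [| q Q q_pr sylQ]; last first.
  (* A nontrivial Sylow subgroup belongs to a prime dividing |G|, hence to some [p i]. *)
  have [Q1 | ntQ] := eqVneq (Q : {set gT}) 1%g; first by rewrite Q1 abelem1.
  have [_ q_dvQ _] := pgroup_pdiv (pHall_pgroup sylQ) ntQ.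
  have [||i qE _] := @dvdn_prod_pfactor a q => //.
    by rewrite -oG (dvdn_trans q_dvQ) // cardSg ?(pHall_sub sylQ).
  by rewrite qE in sylQ *; case: (eq_p i Q sylQ).
(* The quotient [G / H] is a simple p-group, hence of prime order and abelian. *)
have sG'H i H : H \in max_normals (p i) G -> (G^`(1) \subset H)%g.
  move=> mH; have /[!inE] /andP[maxH _] := mH.
  have /andP[sHG nHG] := maxnormal_normal maxH.
  apply: (der1_min nHG); apply/cyclic_abelian/prime_cyclic/simple_sol_prime.
    have pGH : (p i).-group (G / H)%g.
      by rewrite /pgroup card_quotient ?(iGE i H mH).
    exact: pgroup_sol pGH.
  by rewrite quotient_simple ?maxnormal_normal.
apply/derG1P/eqP; apply: contraT; rewrite -cardG_gt1 => G'_gt1.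
have pdiv_G' := pdiv_dvd #|(G^`(1))%g|; have pr_q := pdiv_prime G'_gt1.
have [|i qE _] := @dvdn_prod_pfactor a _ pr_q.
  by rewrite -oG (dvdn_trans pdiv_G') ?cardSg ?der_sub.
rewrite qE in pdiv_G'; have [P sylP] := Sylow_exists (p i) G.
have [_ tiP] := eq_p i P sylP.
(* Here [G^](1) :&: P[is a Sylow subgroup of]G^[(1)] for a prime dividing its order, yet it lies in
   every [H] and in [P], hence is trivial. *)
have := card_Hall (Sylow_setI_normal (der_normal 1 G) sylP).
have /trivgP-> : (G^`(1) :&: P \subset [1 gT])%g.
  by rewrite -tiP setSI //; apply/bigcapsP=> H; apply: sG'H.
move/eqP; rewrite cards1 eq_sym eqn_leq leqNgt p_part_gt1 mem_primes.
by rewrite p_prime cardG_gt0 pdiv_G'.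
Qed.

(** In an abelian group every maximal normal subgroup has prime index, so each is counted once and
    its order is exactly the lowered product. The hypotheses pass to it and every inequality of the
    induction becomes an equality. *)
Lemma card_comp_series_abelian a G : #|G| = (\prod_i p i ^ a i)%N ->
    abelian G ->
    (forall i P, (p i).-Sylow(G)%g P -> (p i).-abelem%g P) ->
  #|comp_series G|%:R = comp_series_bound p a.
Proof.
have [n] := ubnP (\sum_i a i)%N; elim: n a G => // n IHn a G lt_a_n oG cGG abG.
have dvG : (#|G| %| \prod_i p i ^ a i)%N by rewrite oG.
have [a0 | a_gt0] := posnP (\sum_i a i)%N.
  rewrite comp_series_bound0 // card_comp_series1 //; apply/card1_trivg.
  move/eqP: a0; rewrite sum_nat_eq0 oG => /forallP a0.
  by rewrite big1 // => i _; rewrite (eqP (implyP (a0 i) _)).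
have ntG : G :!=: 1%g.
  move: a_gt0; rewrite lt0n; apply: contraNneq => G1; rewrite big1 // => i _.
  by rewrite -(logn_prod_pfactor p_inj p_prime a i) -oG G1 cards1 logn1.
have iG_prime H : maxnormal H G G -> prime #|G : H|.
  by apply: index_maxnormal_sol_prime; apply: abelian_sol.
have iGE i H : H \in max_normals (p i) G -> #|G : H| = p i.
  rewrite inE => /andP[maxH]; rewrite dvdn_prime2 ?iG_prime //.
  by move/eqP.
rewrite (eqTleqif (leqif_card_comp_series ntG dvG)); last first.
  apply/forall_inP=> H maxH; have iH_pr := iG_prime H maxH.
  have [|i iHE _] := @dvdn_prod_pfactor a _ iH_pr.
    by rewrite -oG dvdn_indexg.
  apply/cards1P; exists i; apply/setP=> j; rewrite !inE iHE dvdn_prime2 //.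
  exact: inj_eq.
rewrite comp_series_bound_rec // natr_sum; apply: eq_bigr => i _.
have [P sylP] := Sylow_exists (p i) G.
have := card_max_normals_abelian (p_prime i) cGG sylP (abG i P sylP).
rewrite oG logn_prod_pfactor // => <-.
rewrite natr_sum mulr_natl -sumr_const; apply: eq_bigr => H mH.
have [ai_gt0 _] := max_normals_lower dvG mH.
have sHG : (H \subset G)%g by move: mH; rewrite inE => /andP[/maxnormal_sub].
apply: IHn; first by move: lt_a_n; rewrite (sum_lower ai_gt0).
- apply/eqP; rewrite -(eqn_pmul2l (prime_gt0 (p_prime i))) -prod_lower //.
  by rewrite -oG -(Lagrange sHG) (iGE i H mH) mulnC.
- exact: abelianS cGG.
move=> j Q sylQ.
have sQG := subset_trans (pHall_sub sylQ) sHG.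
have [R sylR sQR] := Sylow_superset sQG (pHall_pgroup sylQ).
exact: abelemS sQR (abG j R sylR).
Qed.
End UpperBound.

Theorem theorem3p7 (gT : finGroupType) (G : {group gT})
    (r : nat) (p a : 'I_r -> nat)
    (p_inj : injective p)
    (p_prime : forall i, prime (p i))
    (a_gt0 : forall i, (0 < a i)%N)
    (oG : #|G| = (\prod_(i < r) p i ^ a i)%N) :
  (#|comp_series G|%:R <= comp_series_bound p a)%R /\
  (#|comp_series G|%:R%R = comp_series_bound p a <->
    abelian G /\
    (forall (q : nat) (Q : {group gT}),
       prime q -> (q.-Sylow(G) Q)%g -> (q.-abelem Q)%g)).
Proof.
have dvG : #|G| %| (\prod_i p i ^ a i)%N by rewrite oG.
split; first exact: card_comp_series_le.
split=> [eqB | [cGG abG]].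
  exact: card_comp_series_eq_bound_abelian oG eqB.
by apply: card_comp_series_abelian => // i P; apply: abG.
Qed.
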